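(* Let $V=\mathbb C^m$ carry a non-degenerate symmetric bilinear form $(-,-)$, let $G=O(m,\mathbb C)$ be its isometry group, let $d\ge1$, and let $\kappa:B_{2d}^0(\mathbb C)\to (T^{2d}(V)^* )^G$ be the linear map $D\mapsto\kappa_D$. (a) If $d\leq m$, then $\mathrm{Ker}(\kappa)=0$. (b) Assume $d\ge m+1$. Let $S,S'$ be disjoint subsets of $\{1,\dots,2d\}$ with $|S|=|S'|=m+1$, whose elements in increasing order are $s_1<\dots<s_{m+1}$ and $s'_1<\dots<s'_{m+1}$, and let $P$ be a partition of $\{1,\dots,2d\}\setminus(S\cup S')$ into pairs. For $\sigma\in\mathrm{Sym}(S)$ let $D(S,S',P;\sigma)$ be the diagram in $B_{2d}^0$ which pairs $\sigma(s_i)$ with $s'_i$ for $i=1,\dots,m+1$ and pairs the remaining points according to $P$. Then for all such $S,S',P$, $$\sum_{\sigma\in\mathrm{Sym}(S)}\varepsilon(\sigma)\,\kappa_{D(S,S',P;\sigma)}=0,$$ where $\varepsilon$ is the sign character, and all linear relations among the $\kappa_D$ are linear consequences (i.e. linear combinations) of these relations.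
   Context: $B_{2d}^0(\mathbb C)$ is the complex vector space with basis the Brauer diagrams $2d\to 0$, i.e. the partitions of $\{1,\dots,2d\}$ into $d$ pairs. $T^{2d}(V)=V^{\otimes 2d}$. For a diagram $D$ with pairs $\{i_1,j_1\},\dots,\{i_d,j_d\}$, $\kappa_D\in (T^{2d}(V)^* )^G$ is defined by $\kappa_D(v_1\otimes\dots\otimes v_{2d})=\prod_{k=1}^d(v_{i_k},v_{j_k})$. *)

(* Defs.v *)
From HB Require Import structures.
From mathcomp Require Export all_boot all_algebra perm.
From mathcomp Require Import boolp.
From mathcomp Require Export reals complex.

Set Implicit Arguments.
Unset Strict Implicit.
Unset Printing Implicit Defensive.

Import GRing.Theory.
Local Open Scope ring_scope.

Section TensorPower.
Variables (F : fieldType) (m n : nat).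
Local Notation V := 'rV[F]_m.

(* The n-th tensor power of F^m in coordinates: t h is the coefficient of t    *)
(* on the basis tensor e_(h 0) (x) ... (x) e_(h (n-1)).  The universal         *)
(* property is given by tensor_liftE and tensor_ext below.                     *)
Definition tensor_power : vectType F := {ffun {ffun 'I_n -> 'I_m} -> F^o}.

Definition pure_tensor (v : 'I_n -> V) : tensor_power :=
  [ffun h : {ffun 'I_n -> 'I_m} => \prod_k v k 0 (h k)].

Definition upd (v : 'I_n -> V) (k : 'I_n) (x : V) : 'I_n -> V :=
  fun j => if j == k then x else v j.

Definition multilinear (W : lmodType F) (f : ('I_n -> V) -> W) : Prop :=
  forall v k, linear (fun x => f (upd v k x)).

Definition tensor_lift_fun (W : vectType F) (f : ('I_n -> V) -> W)
    (t : tensor_power) : W :=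
  \sum_h t h *: f (fun k => 'e_(h k)).

Definition tensor_lift (W : vectType F) (f : ('I_n -> V) -> W) :
  'Hom(tensor_power, W) := linfun (tensor_lift_fun f).

Lemma tensor_lift_fun_linear (W : vectType F) (f : ('I_n -> V) -> W) :
  linear (tensor_lift_fun f).
Proof.
move=> a s t; rewrite /tensor_lift_fun scaler_sumr -big_split /=.
by apply: eq_bigr => h _; rewrite !ffunE scalerDl scalerA.
Qed.

HB.instance Definition _ (W : vectType F) (f : ('I_n -> V) -> W) :=
  GRing.isLinear.Build F tensor_power W _ (tensor_lift_fun f)
    (tensor_lift_fun_linear f).

Lemma upd_id v k : upd v k (v k) = v.
Proof. by apply/funext => j; rewrite /upd; case: eqP => [->|]. Qed.

Lemma pure_basis (h : {ffun 'I_n -> 'I_m}) :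
  pure_tensor (fun k => 'e_(h k)) = [ffun h' => (h' == h)%:R].
Proof.
apply/ffunP => h'; rewrite !ffunE.
case: eqP => [->|/eqP ne].
  by rewrite big1 // => k _; rewrite mxE !eqxx.
have [k nek] : exists k, h' k != h k.
  apply/existsP; apply: contraR ne => /existsPn H.
  by apply/eqP/ffunP => k; apply/eqP; rewrite -[_ == _]negbK.
by rewrite (bigD1 k) //= mxE (negbTE nek) andbF mul0r.
Qed.

Lemma pure_multilinear : multilinear pure_tensor.
Proof.
move=> v k a x y; apply/ffunP => h; rewrite !ffunE.
have E z : \prod_j upd v k z j 0 (h j) = z 0 (h k) * \prod_(j | j != k) v j 0 (h j).
  rewrite (bigD1 k) //= /upd eqxx; congr (_ * _).
  by apply: eq_bigr => j /negbTE->.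
by rewrite !E !mxE mulrDl -mulrA.
Qed.

Lemma multilinear_lfun (W W' : vectType F) (f : ('I_n -> V) -> W)
    (phi : 'Hom(W, W')) : multilinear f -> multilinear (phi \o f).
Proof. by move=> lf v k a x y /=; rewrite lf linearP. Qed.

Lemma multilinear_sum (W : lmodType F) (f : ('I_n -> V) -> W) v k :
  multilinear f -> f v = \sum_j v k 0 j *: f (upd v k 'e_j).
Proof.
move=> lf; rewrite -{1}(upd_id v k) [X in upd v k X]row_sum_delta.
pose g x := f (upd v k x).
have g0 : g 0 = 0.
  by apply: (@addrI _ (g 0)); rewrite addr0 -{1}[g 0]scale1r -lf scale1r addr0.
rewrite -/(g _); elim: (index_enum _) => [|j r IH]; first by rewrite !big_nil.
by rewrite !big_cons -IH /g lf.
Qed.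

Lemma multilinear_ext (W : lmodType F) (f g : ('I_n -> V) -> W) :
    multilinear f -> multilinear g ->
    (forall h : {ffun 'I_n -> 'I_m},
       f (fun k => 'e_(h k)) = g (fun k => 'e_(h k))) ->
  f =1 g.
Proof.
move=> lf lg fg.
suff H i v : (forall k : 'I_n, (i <= k)%N -> exists j, v k = 'e_j) -> f v = g v.
  by move=> v; apply: (H n) => k; rewrite leqNgt ltn_ord.
elim: i v => [|i IH] v Hv.
  have /choice [h vh] : forall k, exists j, v k = 'e_j by move=> k; apply: Hv.
  have -> : v = fun k => 'e_([ffun k => h k] k).
    by apply/funext => k; rewrite ffunE vh.
  exact: fg.
have [ltin | leni] := ltnP i n; last first.
  by apply: IH => k leik; have := leq_trans leni leik; rewrite leqNgt ltn_ord.
pose k0 := Ordinal ltin.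
rewrite (multilinear_sum v k0 lf) (multilinear_sum v k0 lg).
apply: eq_bigr => j _; congr (_ *: _); apply: IH => k leik.
rewrite /upd; case: (eqVneq k k0) => [_|nek]; first by exists j.
apply: Hv; rewrite ltn_neqAle leik andbT eq_sym.
by apply: contraNneq nek => e; apply/eqP/val_inj.
Qed.

Lemma tensor_liftE (W : vectType F) (f : ('I_n -> V) -> W) v :
  multilinear f -> tensor_lift f (pure_tensor v) = f v.
Proof.
move=> lf; move: v.
apply: multilinear_ext => //.
  exact: (multilinear_lfun (tensor_lift f) pure_multilinear).
move=> h; rewrite lfunE /= /tensor_lift_fun pure_basis (bigD1 h) //= big1 => [|h' ne].
  by rewrite ffunE eqxx scale1r addr0.
by rewrite ffunE (negbTE ne) scale0r.
Qed.

Lemma tensor_ext (W : vectType F) (phi psi : 'Hom(tensor_power, W)) :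
  (forall v, phi (pure_tensor v) = psi (pure_tensor v)) -> phi = psi.
Proof.
move=> E; apply/lfunP => t.
have -> : t = \sum_h t h *: pure_tensor (fun k => 'e_(h k)).
  apply/ffunP => h; rewrite sum_ffunE (bigD1 h) //= big1 => [|h' ne].
    by rewrite pure_basis !ffunE eqxx addr0 [_ *: _]mulr1.
  by rewrite pure_basis !ffunE eq_sym (negbTE ne) [_ *: _]mulr0.
by rewrite !linear_sum; apply: eq_bigr => h _; rewrite !linearZ /= E.
Qed.

Definition tensor_map (g : 'End(V)) : 'End(tensor_power) :=
  tensor_lift (fun v => pure_tensor (fun k => g (v k))).

Lemma tensor_mapE g v :
  tensor_map g (pure_tensor v) = pure_tensor (fun k => g (v k)).
Proof.
apply: (@tensor_liftE _ (fun v => pure_tensor (fun k => g (v k)))).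
move=> {}v k a x y.
have E z : (fun j => g (upd v k z j)) = upd (fun j => g (v j)) k (g z).
  by apply/funext => j; rewrite /upd; case: ifP.
by rewrite !E linearP pure_multilinear.
Qed.

End TensorPower.

Section Invariants.
Variables (F : fieldType) (m : nat) (b : {symmetric 'rV[F]_m}) (n : nat).
Local Notation T := (tensor_power F m n).

Definition orthogonal_group (g : 'End('rV[F]_m)) : Prop :=
  lker g == 0%VS /\ isometry b b g.

(* The contragredient action of g on the dual of the tensor power. *)
Definition dual_act (g : 'End('rV[F]_m)) (phi : 'Hom(T, F^o)) : 'Hom(T, F^o) :=
  (phi \o tensor_map n (g^-1)%VF)%VF.

Definition invariant : {pred 'Hom(T, F^o)} :=
  fun phi => `[< forall g, orthogonal_group g -> dual_act g phi = phi >].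

Lemma invariant_submod : submod_closed invariant.
Proof.
split=> [|a phi psi]; first by apply/asboolP => g _; rewrite /dual_act comp_lfun0l.
move=> /asboolP iphi /asboolP ipsi; apply/asboolP => g Gg.
rewrite -{2}(iphi g Gg) -{2}(ipsi g Gg) /dual_act.
by apply/lfunP => t; rewrite !lfunE /= !lfunE /= !lfunE /= !lfunE.
Qed.

HB.instance Definition _ :=
  GRing.isSubmodClosed.Build F 'Hom(T, F^o) invariant invariant_submod.

Record inv_dual := InvDual {
  inv_val :> 'Hom(T, F^o);
  inv_valP : inv_val \in invariant }.

HB.instance Definition _ := [isSub for inv_val].
HB.instance Definition _ := [Choice of inv_dual by <:].
HB.instance Definition _ := [SubChoice_isSubLmodule of inv_dual by <:].

End Invariants.

Section Diagrams.

Definition is_pairing (T : finType) (A : {set T}) (D : {set {set T}}) : bool :=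
  partition D A && [forall B in D, #|B| == 2].

(* The Brauer diagrams from n points to 0 points. *)
Definition brauer n := {D : {set {set 'I_n}} | is_pairing [set: 'I_n] D}.

Definition brauer_space (F : fieldType) n : vectType F :=
  {ffun brauer n -> F^o}.

Definition diagram_vec (F : fieldType) n (D : brauer n) : brauer_space F n :=
  [ffun E => (E == D)%:R].

Lemma partitionU (T : finType) (A B : {set T}) (P Q : {set {set T}}) :
  [disjoint A & B] -> partition P A -> partition Q B -> partition (P :|: Q) (A :|: B).
Proof.
move=> dAB /and3P[/eqP cP tP nP] /and3P[/eqP cQ tQ nQ].
apply/and3P; split.
- by rewrite /cover bigcup_setU -/(cover P) -/(cover Q) cP cQ.
- by apply: trivIsetU; rewrite // cP cQ.
- by rewrite inE negb_or nP nQ.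
Qed.

Lemma pairingU (T : finType) (A B : {set T}) (P Q : {set {set T}}) :
  [disjoint A & B] -> is_pairing A P -> is_pairing B Q ->
  is_pairing (A :|: B) (P :|: Q).
Proof.
move=> dAB /andP[pP /forall_inP cP] /andP[pQ /forall_inP cQ].
rewrite /is_pairing partitionU //=.
by apply/forall_inP => X /setUP[/cP|/cQ].
Qed.

Lemma pairing_matching (T : finType) k (f g : 'I_k -> T) (A B : {set T}) :
    injective f -> injective g -> f @: setT = A -> g @: setT = B ->
    [disjoint A & B] ->
  is_pairing (A :|: B) [set [set f i; g i] | i : 'I_k].
Proof.
move=> injf injg <- <- dAB.
have fg i j : f i != g j.
  apply: contraTneq dAB => e; apply/pred0Pn; exists (f i).
  by rewrite /= imset_f // e imset_f.
apply/andP; split; last first.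
  by apply/forall_inP => _ /imsetP[i _ ->]; rewrite cards2 fg.
apply/and3P; split.
- apply/eqP/setP => x; apply/bigcupP/setUP => [[_ /imsetP[i _ ->]]|].
    by rewrite !inE => /orP[]/eqP->; [left|right]; rewrite imset_f.
  by case=> /imsetP[i _ ->]; exists [set f i; g i];
    rewrite ?set21 ?set22 //; apply/imsetP; exists i.
- apply/trivIsetP => _ _ /imsetP[i _ ->] /imsetP[j _ ->] ne.
  have nij : i != j by apply: contraNneq ne => ->.
  rewrite -setI_eq0; apply/eqP/setP => x; rewrite !inE; apply/negP.
  case/andP=> /orP[]/eqP->; rewrite ?(inj_eq injf) ?(inj_eq injg) (negbTE nij) ?orbF /=.
    by rewrite (negbTE (fg _ _)).
  by rewrite eq_sym (negbTE (fg _ _)).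
- apply/negP => /imsetP[i _ /setP/(_ (f i))].
  by rewrite !inE eqxx.
Qed.

End Diagrams.

Section Kappa.
Variables (F : fieldType) (m : nat) (b : {symmetric 'rV[F]_m}) (n : nat).

Definition kappa_form (D : brauer n) (v : 'I_n -> 'rV[F]_m) : F^o :=
  \prod_(p : 'I_n * 'I_n | (p.1 < p.2)%N && ([set p.1; p.2] \in val D))
    b (v p.1) (v p.2).

Definition kappa_fun (D : brauer n) : 'Hom(tensor_power F m n, F^o) :=
  tensor_lift (kappa_form D).

Lemma kappa_form_multilinear D : multilinear (kappa_form D).
Proof.
case: D => D pD; rewrite /kappa_form /=.
case/andP: (pD) => /and3P[/eqP cD tD _] /forall_inP card2 v k a x y.
have kD : k \in cover D by rewrite cD inE.
have BD := pblock_mem kD; have kB : k \in pblock D k by rewrite mem_pblock.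
have [p [ltp eqB]] : exists p : 'I_n * 'I_n,
    (p.1 < p.2)%N /\ pblock D k = [set p.1; p.2].
  have /cards2P[i [j [nij ->]]] := card2 _ BD.
  case: (ltngtP i j) => [ltij|ltji|/val_inj eij]; first by exists (i, j).
    by exists (j, i); rewrite setUC.
  by rewrite eij eqxx in nij.
have inP : (p.1 < p.2)%N && ([set p.1; p.2] \in D) by rewrite ltp -eqB.
have rest z : \prod_(q : 'I_n * 'I_n |
       ((q.1 < q.2)%N && ([set q.1; q.2] \in D)) && (q != p))
       b (upd v k z q.1) (upd v k z q.2) =
    \prod_(q : 'I_n * 'I_n |
       ((q.1 < q.2)%N && ([set q.1; q.2] \in D)) && (q != p))
       b (v q.1) (v q.2).
  apply: eq_bigr => -[i j] /= /andP[/andP[ltij ijD] nep].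
  have nk : k \notin [set i; j].
    apply: contra nep => kij.
    have eqij : [set i; j] = [set p.1; p.2] by rewrite -eqB (def_pblock tD ijD kij).
    have : i \in [set p.1; p.2] by rewrite -eqij !inE eqxx.
    have : j \in [set p.1; p.2] by rewrite -eqij !inE eqxx orbT.
    case: p ltp eqij {eqB inP} => p1 p2 /= ltp eqij.
    rewrite !inE => /orP[]/eqP ej /orP[]/eqP ei; subst i j => //.
    - by rewrite ltnn in ltij.
    - by have := ltn_trans ltp ltij; rewrite ltnn.
    - by rewrite ltnn in ltij.
  move: nk; rewrite !inE negb_or => /andP[/negbTE ki /negbTE kj].
  by rewrite /upd ![_ == k]eq_sym ki kj.
have nep : p.1 != p.2 by rewrite -val_eqE neq_ltn ltp.
rewrite !(bigD1 p inP) /= !rest [_ *: (_ * _)]mulrA -mulrDl; congr (_ * _).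
move: kB; rewrite eqB !inE /upd => /orP[]/eqP ek.
  by rewrite ek eqxx [p.2 == _]eq_sym (negbTE nep) linearPl.
by rewrite ek eqxx (negbTE nep) linearPr.
Qed.

Lemma kappa_funE D v : kappa_fun D (pure_tensor v) = kappa_form D v.
Proof. exact/tensor_liftE/kappa_form_multilinear. Qed.

Lemma kappa_fun_invariant D : kappa_fun D \in @invariant F m b n.
Proof.
apply/asboolP => g [g0 gb]; apply: tensor_ext => v.
rewrite lfunE /= tensor_mapE !kappa_funE; apply: eq_bigr => p _.
by rewrite -[LHS]gb !(lker0_lfunVK g0).
Qed.

Definition kappa_diag (D : brauer n) : inv_dual b n :=
  InvDual (kappa_fun_invariant D).

Definition kappa (x : brauer_space F n) : inv_dual b n :=
  \sum_D (x D : F) *: kappa_diag D.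

Lemma kappa_linear : linear kappa.
Proof.
move=> a x y; rewrite /kappa scaler_sumr -big_split /=.
by apply: eq_bigr => h _; rewrite !ffunE scalerDl scalerA.
Qed.

HB.instance Definition _ :=
  GRing.isLinear.Build F (brauer_space F n) (inv_dual b n) _ kappa kappa_linear.

Lemma kappa_vec D : kappa (diagram_vec F D) = kappa_diag D.
Proof.
rewrite /kappa (bigD1 D) //= big1 => [|E ne].
  by rewrite ffunE eqxx scale1r addr0.
by rewrite ffunE (negbTE ne) scale0r.
Qed.

End Kappa.

Section Relations.
Variables (m n : nat).

Definition is_rel_datum (t : {set 'I_n} * {set 'I_n} * {set {set 'I_n}}) : bool :=
  let: (S1, S2, P) := t in
  [&& #|S1| == m.+1, #|S2| == m.+1, [disjoint S1 & S2]
    & is_pairing (~: (S1 :|: S2)) P].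

Definition rel_datum := {t | is_rel_datum t}.

Variable t : rel_datum.
Definition rel_S : {set 'I_n} := (val t).1.1.
Definition rel_S' : {set 'I_n} := (val t).1.2.
Definition rel_P : {set {set 'I_n}} := (val t).2.

Lemma rel_datumP :
  [/\ #|rel_S| = m.+1, #|rel_S'| = m.+1, [disjoint rel_S & rel_S']
    & is_pairing (~: (rel_S :|: rel_S')) rel_P].
Proof.
rewrite /rel_S /rel_S' /rel_P; case: t => -[[S1 S2] P] /= /and4P[cS cS' dS pP].
by split=> //; apply/eqP.
Qed.

Lemma card_rel_S : m.+1 = #|rel_S|. Proof. by case: rel_datumP. Qed.
Lemma card_rel_S' : m.+1 = #|rel_S'|. Proof. by case: rel_datumP. Qed.

(* enum lists a set of ordinals in increasing order, see pt_increasing. *)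
Definition ptS (i : 'I_m.+1) : {x | x \in rel_S} :=
  let j := cast_ord card_rel_S i in exist _ (enum_val j) (enum_valP j).
Definition ptS' (i : 'I_m.+1) : {x | x \in rel_S'} :=
  let j := cast_ord card_rel_S' i in exist _ (enum_val j) (enum_valP j).

Lemma enum_val_ord_increasing (A : {set 'I_n}) (i j : 'I_#|A|) :
  (i < j)%N -> (enum_val i < enum_val j)%N.
Proof.
move=> ltij; have x0 := enum_val i.
rewrite !(enum_val_nth x0).
have trl : transitive (fun x y : 'I_n => (x < y)%N) by move=> y x z; apply: ltn_trans.
have so : sorted (fun x y : 'I_n => (x < y)%N) (enum A).
  rewrite {1}/enum_mem -enumT; apply: sorted_filter => //.
  have := iota_ltn_sorted 0 n.
  by rewrite -val_enum_ord sorted_map.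
by apply: (sorted_ltn_nth trl x0 so) => //; rewrite inE -cardE.
Qed.

Lemma pt_increasing (i j : 'I_m.+1) : (i < j)%N ->
  (val (ptS i) < val (ptS j))%N /\ (val (ptS' i) < val (ptS' j))%N.
Proof. by move=> ltij; split; apply: enum_val_ord_increasing. Qed.

Definition rel_pairs (s : {perm {x | x \in rel_S}}) : {set {set 'I_n}} :=
  rel_P :|: [set [set val (s (ptS i)); val (ptS' i)] | i : 'I_m.+1].

Lemma rel_pairs_pairing s : is_pairing [set: 'I_n] (rel_pairs s).
Proof.
have [cS cS' dS pP] := rel_datumP.
have iS : injective (fun i => val (s (ptS i))).
  by move=> i j /val_inj/perm_inj/(congr1 val)/enum_val_inj/cast_ord_inj.
have iS' : injective (fun i => val (ptS' i)).
  by move=> i j /enum_val_inj/cast_ord_inj.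
rewrite -(setUCr (rel_S :|: rel_S')) setUC; apply: pairingU => //.
  by rewrite -setI_eq0 setIC setICr.
apply: pairing_matching => //; apply/eqP; rewrite eqEcard card_imset // cardsT card_ord.
  by rewrite cS leqnn andbT; apply/subsetP => _ /imsetP[i _ ->]; apply: valP.
by rewrite cS' leqnn andbT; apply/subsetP => _ /imsetP[i _ ->]; apply: valP.
Qed.

Definition rel_diagram (s : {perm {x | x \in rel_S}}) : brauer n :=
  exist _ (rel_pairs s) (rel_pairs_pairing s).

End Relations.

Definition rel_vec (F : fieldType) m n (t : rel_datum m n) : brauer_space F n :=
  \sum_(s : {perm {x | x \in rel_S t}})
     (-1) ^+ odd_perm s *: diagram_vec F (rel_diagram s).

(* Main.v *)
From mathcomp Require Import all_order boolp.
Require Import Defs.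

(* Read a diagram D as a fixed-point-free involution w of the points.  If w is
   increasing on a set S of m+1 points, then S and w(S) are disjoint, and D is
   the identity term of the relation attached to S, w(S) and the remaining
   pairs; every other term has a lexicographically larger involution.  Hence,
   modulo the relations, every diagram is a combination of the "short" ones,
   on which w has no increasing subsequence of length m+1.

   The short diagrams have independent kappa_D: let level(i) be the length of
   the longest increasing subsequence of w ending at i.  By the symmetry of w,
   level(w(i)) = level(i), and w is decreasing on each level set, hence
   lexicographically largest among the matchings of that set.  Evaluating at orthogonal
   vectors v_i = f(level(i)) therefore kills kappa_E unless E <= D, so that the
   evaluation matrix is triangular.  When d <= m all diagrams are short. *)

Set Implicit Arguments.
Unset Strict Implicit.
Unset Printing Implicit Defensive.

Import Order.TTheory GRing.Theory Num.Theory.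
Local Open Scope ring_scope.

(** * Diagrams as involutions: lexicographic order, increasing chains and levels *)

Section Partner.
Variable n : nat.
Implicit Types (D E : brauer n) (i j : 'I_n) (S : {set 'I_n}).

(** The default [i] is never returned, because every point lies in a two-element block; see
    [partnerP]. *)
Definition partner D i : 'I_n :=
  odflt i [pick j | (j != i) && ([set i; j] \in val D)].

Lemma block_uniq D (B C : {set 'I_n}) i :
  B \in val D -> C \in val D -> i \in B -> i \in C -> B = C.
Proof.
case: (andP (valP D)) => /and3P[_ tD _] _ BD CD iB iC.
by rewrite -(def_pblock tD BD iB) (def_pblock tD CD iC).
Qed.

Lemma partnerP D i : partner D i != i /\ [set i; partner D i] \in val D.
Proof.
rewrite /partner; case: pickP => [j /andP[] // | none].
case: (andP (valP D)) => /and3P[/eqP cD _ _] /forall_inP card2.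
have iD : i \in cover (val D) by rewrite cD inE.
have BD := pblock_mem iD; have iB : i \in pblock (val D) i by rewrite mem_pblock.
have /cards2P[j [k [njk e]]] := card2 _ BD.
move: BD iB; rewrite e !inE => BD /orP[]/eqP ei.
  by have := none k; rewrite ei eq_sym njk BD.
by have := none j; rewrite ei njk setUC BD.
Qed.

Lemma partner_neq D i : partner D i != i.
Proof. by case: (partnerP D i). Qed.

Lemma partner_block D i : [set i; partner D i] \in val D.
Proof. by case: (partnerP D i). Qed.

Lemma partner_eq D i j : i != j -> [set i; j] \in val D -> partner D i = j.
Proof.
move=> nij ijD.
have := block_uniq ijD (partner_block D i) (set21 _ _) (set21 _ _).
by move/setP/(_ j); rewrite !inE eqxx orbT eq_sym (negbTE nij) => /esym/eqP.
Qed.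

Lemma partnerK D : involutive (partner D).
Proof.
move=> i; apply: partner_eq; first exact: partner_neq.
by rewrite setUC partner_block.
Qed.

Lemma partner_inj D : injective (partner D).
Proof. exact: inv_inj (partnerK D). Qed.

Lemma blockP D (B : {set 'I_n}) :
  reflect (exists i, B = [set i; partner D i]) (B \in val D).
Proof.
apply: (iffP idP) => [BD|[i ->]]; last exact: partner_block.
case: (andP (valP D)) => _ /forall_inP/(_ _ BD)/cards2P[i [j [nij eB]]].
by exists i; rewrite (partner_eq nij) // -eB.
Qed.

Lemma brauer_ext D E : partner D =1 partner E -> D = E.
Proof.
move=> eDE; apply/val_inj/setP => B.
by apply/blockP/blockP => -[i ->]; exists i; rewrite eDE.
Qed.

(** The type [tuplelexi] supplies the lexicographic total order that governs both the straightening
    and the triangularity argument. *)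
Definition partner_word D : n.-tuplelexi 'I_n := [tuple partner D i | i < n].

Lemma partner_word_inj : injective partner_word.
Proof.
move=> D E /(congr1 (fun t => tnth t)) e; apply: brauer_ext => i.
by have := congr1 (fun g => g i) e; rewrite !tnth_mktuple.
Qed.

Lemma partner_word_ltP D E :
  reflect (exists2 k : 'I_n, forall i : 'I_n, (i < k)%N -> partner D i = partner E i
             & (partner D k < partner E k)%N)
          (partner_word D < partner_word E)%O.
Proof.
apply: (iffP ltxi_tuplePlt) => -[k eqk ltk]; exists k.
- by move=> i /eqk; rewrite !tnth_mktuple.
- by move: ltk; rewrite !tnth_mktuple.
- by move=> i /eqk; rewrite !tnth_mktuple.
- by rewrite !tnth_mktuple.
Qed.

Definition chain D S : bool :=
  [forall i in S, forall j in S, (i < j)%N ==> (partner D i < partner D j)%N].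

Lemma chainP D S :
  reflect {in S &, forall i j : 'I_n, (i < j)%N -> (partner D i < partner D j)%N}
          (chain D S).
Proof.
apply: (iffP 'forall_in_forall_inP) => [cS i j iS jS ij | cS i iS j jS].
  by have /implyP := cS i iS j jS; apply.
by apply/implyP; apply: cS.
Qed.

Lemma chain_lt D S i j : chain D S -> i \in S -> j \in S ->
  (partner D i < partner D j)%N = (i < j)%N.
Proof.
move=> /chainP cS iS jS; apply/idP/idP => [|ij]; last exact: cS.
case: (ltngtP i j) => // [ji|/val_inj->]; last by rewrite ltnn.
by rewrite ltnNge ltnW // cS.
Qed.

Lemma chain_sub D S (S0 : {set 'I_n}) : S0 \subset S -> chain D S -> chain D S0.
Proof.
by move=> /subsetP sS /chainP cS; apply/chainP => i j /sS iS /sS jS; apply: cS.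
Qed.

Lemma chain_partner D S : chain D S -> chain D (partner D @: S).
Proof.
move=> cS; apply/chainP => _ _ /imsetP[i iS ->] /imsetP[j jS ->].
by rewrite !partnerK (chain_lt cS).
Qed.

(** If [x] and its partner [i] both lay in [S], the involution would exchange them and so reverse
    their order; they differ because there is no fixed point. *)
Lemma chain_partner_disjoint D S : chain D S -> [disjoint S & partner D @: S].
Proof.
move=> cS; rewrite -setI_eq0; apply/eqP/setP => x; rewrite !inE; apply/negP.
case/andP => xS /imsetP[i iS ex].
have := chain_lt cS xS iS; rewrite ex partnerK.
have := partner_neq D i; rewrite -val_eqE /=.
by case: ltngtP.
Qed.

Definition level D i : nat :=
  \max_(S | [&& chain D S, i \in S & [forall j in S, (j <= i)%N]]) #|S|.

Lemma level_witness D i : exists S : {set 'I_n},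
  [/\ chain D S, i \in S, {in S, forall j : 'I_n, (j <= i)%N} & level D i = #|S|].
Proof.
pose P S := [&& chain D S, i \in S & [forall j in S, (j <= i)%N]].
have P0 : P [set i].
  apply/and3P; split; last by apply/forall_inP => j /set1P->.
    by apply/chainP => _ _ /set1P-> /set1P->; rewrite ltnn.
  exact: set11.
rewrite /level (bigop.bigmax_eq_arg _ P0) //.
case: arg_maxnP => // S /and3P[cS iS /forall_inP mS] _.
by exists S.
Qed.

Lemma level_max D i S : chain D S -> i \in S -> {in S, forall j : 'I_n, (j <= i)%N} ->
  (#|S| <= level D i)%N.
Proof.
move=> cS iS mS; apply: (@leq_bigmax_cond _ _ (fun S : {set 'I_n} => #|S|)).
by rewrite cS iS; apply/forall_inP.
Qed.

Lemma level_gt0 D i : (0 < level D i)%N.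
Proof. by have [S [_ iS _ ->]] := level_witness D i; apply/card_gt0P; exists i. Qed.

(** The involution carries a chain ending at [j] to a chain of the same size ending at
    [partner D j]; applying this twice gives both inequalities. *)
Lemma level_partner D i : level D (partner D i) = level D i.
Proof.
suff le j : (level D j <= level D (partner D j))%N.
  by apply/eqP; rewrite eqn_leq le andbT -{2}(partnerK D i) le.
have [S [cS jS mS ->]] := level_witness D j.
rewrite -(card_imset (mem S) (@partner_inj D)).
apply: level_max; rewrite ?chain_partner ?imset_f //.
move=> _ /imsetP[k kS ->]; have := mS k kS; rewrite leq_eqVlt => /orP[/eqP/val_inj->//|kj].
by rewrite ltnW // (chain_lt cS).
Qed.

Lemma level_lt D i j : (i < j)%N -> (partner D i < partner D j)%N ->
  (level D i < level D j)%N.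
Proof.
move=> ij pij; have [S [cS iS mS ->]] := level_witness D i.
have jS : j \notin S by apply: contraL ij => /mS; rewrite -leqNgt.
(* A longest chain ending at [i] can be prolonged by [j]. *)
have <- : #|j |: S| = #|S|.+1 by rewrite cardsU1 jS.
apply: level_max; first 1 last.
- by rewrite setU11.
- by move=> k /setU1P[->//|/mS ki]; apply: leq_trans (ltnW ij).
apply/chainP => k l /setU1P[->|kS] /setU1P[->|lS]; rewrite ?ltnn //.
- by rewrite ltnNge => /negP[]; apply: leq_trans (mS _ lS) (ltnW ij).
- move=> _; apply: leq_ltn_trans pij.
  have := mS k kS; rewrite leq_eqVlt => /orP[/eqP/val_inj->//|ki].
  by rewrite ltnW // (chain_lt cS).
- by rewrite (chain_lt cS).
Qed.

Lemma level_decr D i j : level D i = level D j -> (i < j)%N ->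
  (partner D j < partner D i)%N.
Proof.
move=> eij ij; case: (ltngtP (partner D i) (partner D j)) => //.
  by move/(level_lt ij); rewrite eij ltnn.
by move=> /val_inj/partner_inj e; rewrite e ltnn in ij.
Qed.

(** At a first position [k] where [E] exceeds [D], put [j := partner E k]. Then [partner D k] and
    [j] share a level of [D], so [partner D j] comes before [k]. There the two involutions agree,
    which gives [partner D j = partner E j = k], a contradiction. *)
Lemma monochromatic_partner_word_le D E :
  (forall i, level D (partner E i) = level D i) -> (partner_word E <= partner_word D)%O.
Proof.
move=> mono; rewrite leNgt; apply/negP => /partner_word_ltP[k eqk ltk].
set j := partner E k in ltk.
have lj : level D (partner D k) = level D j by rewrite level_partner mono.
have := level_decr lj ltk; rewrite partnerK => ltjk.
have : partner E (partner D j) = j by rewrite -eqk // partnerK.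
move/(congr1 (partner E)); rewrite partnerK /j partnerK => e.
by rewrite e ltnn in ltjk.
Qed.

Definition short (m : nat) D : bool := [forall S : {set 'I_n}, chain D S ==> (#|S| <= m)%N].

Lemma short_level m D i : short m D -> (level D i <= m)%N.
Proof.
move=> /forallP sD; have [S [cS _ _ ->]] := level_witness D i.
by have /implyP := sD S; apply.
Qed.

End Partner.

(** * Orthogonal vectors and independence of the short diagrams *)

Section Evaluation.
Variables (F : fieldType) (m : nat) (b : {symmetric 'rV[F]_m}).
Hypothesis char2 : (2%:R : F) != 0.

Lemma formC u v : b u v = b v u.
Proof. by rewrite hermC expr0 mul1r. Qed.

(** Gram-Schmidt without normalization: [p] projects onto the orthogonal complement of the first [k]
    vectors, and the next vector is a non-isotropic [p v]. *)
Lemma orthogonal_family : nondegenerate b ->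
  exists f : nat -> 'rV[F]_m,
    forall i j, (i < m)%N -> (j < m)%N -> (b (f i) (f j) == 0) = (i != j).
Proof.
move=> ndb.
suff H k : (k <= m)%N -> exists f : nat -> 'rV[F]_m,
    forall i j, (i < k)%N -> (j < k)%N -> (b (f i) (f j) == 0) = (i != j).
  exact: H.
elim: k => [_|k IH ltkm]; first by exists (fun=> 0).
have [f fE] := IH (ltnW ltkm).
have fne i : (i < k)%N -> b (f i) (f i) != 0 by move=> ik; rewrite fE ?eqxx.
pose p v := v - \sum_(i < k) (b v (f i) / b (f i) (f i)) *: f i.
have pE v : p v = v - \sum_(i < k) (b v (f i) / b (f i) (f i)) *: f i by [].
clearbody p.
have pf v j : (j < k)%N -> b (p v) (f j) = 0.
  move=> jk; rewrite pE linearBl /= linear_sumlz (bigD1 (Ordinal jk)) //= big1 => [|i ne].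
    by rewrite linearZl_LR /= divfK ?fne // addr0 subrr.
  by rewrite linearZl_LR /=; have /eqP-> : b (f i) (f j) == 0; rewrite ?fE ?mulr0.
have pB u v : p (u + v) = p u + p v.
  rewrite !pE [RHS]addrACA -opprD -big_split /=; congr (_ - _).
  by apply: eq_bigr => i _; rewrite linearDl /= mulrDl scalerDl.
(* Otherwise, by polarization, p maps into the radical, so it vanishes and the
   k < m vectors span. *)
have [v nv] : exists v, b (p v) (p v) != 0.
  apply: contrapT => none.
  have iso v : b (p v) (p v) = 0.
    by apply/eqP; apply: contrapT => /negP nv; apply: none; exists v.
  have bpp u v : b (p u) (p v) = 0.
    have := iso (u + v); rewrite pB linearDl /= !linearDr /= !iso addr0 add0r.
    by rewrite (formC (p v)) -mulr2n -mulr_natl => /eqP; rewrite mulf_eq0 (negbTE char2) => /eqP.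
  have p0 v : p v = 0.
    apply/eqP; rewrite -memv0 -(eqP ndb); apply/mem_orthovP => u _.
    rewrite -(subrK (\sum_(i < k) (b u (f i) / b (f i) (f i)) *: f i) u) -pE.
    rewrite linearDr /= bpp add0r linear_sumr big1 // => i _.
    by rewrite linearZr_LR /= pf ?mulr0.
  have : (fullv <= <<[seq f i | i <- iota 0 k]>>)%VS.
    apply/subvP => v _; rewrite -(subrK (\sum_(i < k) (b v (f i) / b (f i) (f i)) *: f i) v).
    rewrite -pE p0 add0r; apply: memv_suml => i _; apply: memvZ; apply: memv_span.
    by apply: map_f; rewrite mem_iota /=.
  move/dimvS; rewrite dimvf /dim /= mul1n => le.
  have := leq_trans le (dim_span _).
  by rewrite size_map size_iota leqNgt ltkm.
exists (fun i => if i == k then p v else f i) => i j.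
rewrite !ltnS [(i <= k)%N]leq_eqVlt [(j <= k)%N]leq_eqVlt.
case: (eqVneq i k) => [->|nik] /= ik; case: (eqVneq j k) => [->|njk] //= jk.
- by rewrite (negbTE nv).
- by rewrite pf // eqxx.
- by rewrite formC pf // eqxx nik.
- by rewrite fE.
Qed.

Variable n : nat.
Implicit Types (D E : brauer n) (v : 'I_n -> 'rV[F]_m).

Lemma kappa_form_neq0 D v :
  kappa_form b D v != 0 <-> forall i, b (v i) (v (partner D i)) != 0.
Proof.
split=> [/prodf_neq0 H i|H].
  case: (ltngtP i (partner D i)) => [lt|lt|/val_inj e].
  - by apply: (H (i, partner D i)); rewrite /= lt partner_block.
  - rewrite formC; apply: (H (partner D i, i)).
    by rewrite /= lt setUC partner_block.
  - by have := partner_neq D i; rewrite -e eqxx.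
apply/prodf_neq0 => -[i j] /= /andP[ij ijD].
by rewrite -(@partner_eq _ D i j) // -val_eqE neq_ltn ij.
Qed.

Lemma kappa_sumE (I : finType) (c : I -> F) (G : I -> brauer n) v :
  inv_val (\sum_i c i *: kappa_diag b (G i)) (pure_tensor v) =
  \sum_i c i * kappa_form b (G i) v.
Proof.
rewrite -[inv_val _]/(val _) raddf_sum sum_lfunE.
by apply: eq_bigr => i _; apply: etrans (scale_lfunE _ _ _) _; rewrite kappa_funE.
Qed.

(** Take the diagram [D] with least word in the support of [x] and evaluate at vectors adapted to
    its levels. A surviving [E] in the support has a word at most that of [D], hence equals [D], so
    the coefficient of [D] would have to vanish. *)
Lemma kappa_short_inj (x : brauer_space F n) : nondegenerate b ->
  (forall D, x D != 0 -> short m D) -> kappa b x = 0 -> x = 0.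
Proof.
move=> /orthogonal_family[f fE] sx k0; apply/eqP; apply: contrapT => /negP nx.
have [D0 xD0] : exists D, x D != 0.
  apply: contrapT => none; case/negP: nx; apply/eqP/ffunP => D; rewrite ffunE.
  by apply/eqP; apply: contrapT => /negP xD; apply: none; exists D.
case: (@Order.TotalTheory.arg_minP _ _ _ D0 (fun D => x D != 0) (@partner_word n) xD0) =>
  D xD minD.
(* Levels run from 1 to [m] by shortness, while the orthogonal family is indexed from 0. *)
pose v (i : 'I_n) := f (level D i).-1.
have lev i : ((level D i).-1 < m)%N.
  by rewrite prednK ?level_gt0 ?short_level ?sx.
have vE i j : (b (v i) (v j) == 0) = (level D i != level D j).
  by rewrite fE // -eqSS !prednK ?level_gt0.
have := kappa_sumE x id v; rewrite -[\sum_i _]/(kappa b x) k0 /= lfunE /=.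
rewrite (bigD1 D) //= big1 => [|E nE].
  rewrite addr0 => /esym/eqP; rewrite mulf_eq0 (negbTE xD) /=.
  apply/negP/kappa_form_neq0 => i.
  by rewrite vE level_partner eqxx.
apply/eqP; rewrite mulf_eq0; apply: contraNT nE; rewrite negb_or => /andP[xE].
move=> /kappa_form_neq0 mono; apply/eqP/partner_word_inj/le_anti; rewrite minD // andbT.
apply: monochromatic_partner_word_le => i.
by have := mono i; rewrite vE negbK => /eqP.
Qed.

End Evaluation.

(** A determinant of size exceeding [m] vanishes on a matrix that factors through dimension [m].
    After expansion over index functions [f], the pigeonhole principle gives [f x = f y] with
    [x != y], and the transposition of [p x] and [p y] reverses the sign of the inner sum. *)
Lemma alternating_sum_rank0 (F : fieldType) (m : nat) (I T : finType) (p : I -> T)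
    (A : T -> 'I_m -> F) (B : 'I_m -> I -> F) :
  (2%:R : F) != 0 -> injective p -> (m < #|I|)%N ->
  \sum_(s : {perm T}) (-1) ^+ s * \prod_i (\sum_j A (s (p i)) j * B j i) = 0.
Proof.
move=> char2 injp ltmI.
under eq_bigr do rewrite bigA_distr_bigA mulr_sumr.
rewrite exchange_big big1 //= => f _.
have [x [y [nxy fxy]]] : exists x y, x != y /\ f x = f y.
  apply: contrapT => none.
  have : injective f.
    move=> x y fxy; apply/eqP; apply: contrapT => /negP nxy.
    by apply: none; exists x, y.
  by move/leq_card; rewrite card_ord leqNgt ltmI.
under eq_bigr do rewrite big_split /= mulrA.
rewrite -mulr_suml; set S := \sum_s _.
suff SN : S = - S.
  have /eqP : 2%:R * S = 0 by rewrite mulr_natl mulr2n {1}SN addNr.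
  by rewrite mulf_eq0 (negbTE char2) => /eqP->; rewrite mul0r.
rewrite /S [LHS](reindex_inj (mulgI (tperm (p x) (p y)))) -sumrN /=.
apply: eq_bigr => s _.
rewrite odd_permM odd_tperm (inj_eq injp) nxy signr_addb /= expr1 mulN1r mulNr.
congr (- (_ * _)); rewrite [RHS](reindex_inj (@perm_inj _ (tperm x y))).
apply: eq_bigr => i _; rewrite permM -inj_tperm //; congr (A _ _).
by case: tpermP => [->|->|].
Qed.

(** * The alternating relations lie in the kernel *)

Section Relations.
Variables (F : fieldType) (m : nat) (b : {symmetric 'rV[F]_m}) (n : nat).
Implicit Types (D : brauer n) (v : 'I_n -> 'rV[F]_m) (t : rel_datum m n).

Lemma form_expand (u w : 'rV[F]_m) : b u w = \sum_j u 0 j * b 'e_j w.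
Proof.
rewrite {1}[u]row_sum_delta linear_sumlz.
by apply: eq_bigr => j _; rewrite linearZl_LR.
Qed.

(** For a two-element [B] exactly one increasing pair contributes, so no endpoint of the block has
    to be chosen. *)
Definition block_form v (B : {set 'I_n}) : F :=
  \prod_(p : 'I_n * 'I_n | (p.1 < p.2)%N && ([set p.1; p.2] == B)) b (v p.1) (v p.2).

Lemma kappa_form_blocks D v : kappa_form b D v = \prod_(B in val D) block_form v B.
Proof.
rewrite /kappa_form (partition_big (fun p => [set p.1; p.2]) (mem (val D))) /=.
  apply: eq_bigr => B BD; apply: eq_bigl => p.
  by case: eqP => [->|_]; rewrite ?BD ?andbF ?andbT.
by move=> p /andP[].
Qed.

Lemma block_form2 v i j : i != j -> block_form v [set i; j] = b (v i) (v j).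
Proof.
wlog ij : i j / (i < j)%N => [H nij|_].
  case: (ltngtP i j) => [ij|ji|/val_inj e]; first exact: H.
    by rewrite setUC formC H // eq_sym.
  by rewrite e eqxx in nij.
rewrite /block_form (big_pred1 (i, j)) // => -[k l] /=; apply/andP/eqP => [|[-> ->]//].
case=> kl /eqP/setP e.
have := e k; have := e l; rewrite !inE !eqxx orbT.
move=> /esym/orP[]/eqP el /esym/orP[]/eqP ek; subst => //.
- by rewrite ltnn in kl.
- by have := ltn_trans kl ij; rewrite ltnn.
- by rewrite ltnn in kl.
Qed.

(** The blocks of [rel_P t] give a factor independent of [s]; what remains is one term of the
    Leibniz expansion of a determinant of size [m.+1]. *)
Lemma kappa_form_rel t (s : {perm {x | x \in rel_S t}}) v :
  kappa_form b (rel_diagram s) v =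
  (\prod_(B in rel_P t) block_form v B) *
  \prod_i b (v (val (s (ptS t i)))) (v (val (ptS' t i))).
Proof.
have [cS cS' dS /andP[/and3P[/eqP cP _ _] _]] := rel_datumP t.
have nSS' i j : val (s (ptS t i)) != val (ptS' t j).
  by apply: contraTneq (valP (ptS' t j)) => <-; rewrite (disjointFr dS) //; apply: valP.
have injS' : injective (fun i => val (ptS' t i)).
  by move=> i j /enum_val_inj/cast_ord_inj.
rewrite kappa_form_blocks /= /rel_pairs.
rewrite (eq_bigl [predU rel_P t & [set [set val (s (ptS t i)); val (ptS' t i)] | i : 'I_m.+1]]);
  last by move=> B; rewrite !inE.
rewrite bigU; last first.
  (* Each matching block contains a point of [rel_S' t], which [rel_P t] does not cover. *)
  rewrite disjoint_sym; apply/pred0P => B /=; apply/negP => /andP[/imsetP[i _ ->]] BP.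
  have : val (ptS' t i) \in cover (rel_P t).
    by apply/bigcupP; eexists; [exact: BP|rewrite set22].
  by rewrite cP !inE (valP (ptS' t i)) orbT.
congr (_ * _); rewrite big_imset => [|i j _ _ /setP/(_ (val (ptS' t i)))]; last first.
  by rewrite !inE eqxx orbT eq_sym (negbTE (nSS' _ _)) /= => /esym/eqP/injS'.
by apply: eq_bigr => i _; rewrite block_form2.
Qed.

Lemma kappa_diag_rel t : (2%:R : F) != 0 ->
  \sum_(s : {perm {x | x \in rel_S t}}) (-1) ^+ s *: kappa_diag b (rel_diagram s) = 0.
Proof.
move=> char2; apply: val_inj; apply: tensor_ext => v.
rewrite [LHS](kappa_sumE b) [RHS]lfunE /=.
(* Expanding the first argument of each form value in the standard basis shows that the matrix of
   values factors through dimension [m]. *)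
transitivity (\prod_(B in rel_P t) block_form v B *
    \sum_(s : {perm {x | x \in rel_S t}}) (-1) ^+ s *
      \prod_i \sum_j v (val (s (ptS t i))) 0 j * b 'e_j (v (val (ptS' t i)))).
  rewrite mulr_sumr; apply: eq_bigr => s _; rewrite kappa_form_rel mulrCA.
  by congr (_ * (_ * _)); apply: eq_bigr => i _; apply: form_expand.
rewrite (@alternating_sum_rank0 _ _ _ _ (ptS t) (fun x j => v (val x) 0 j)
  (fun j i => b 'e_j (v (val (ptS' t i))))) ?mulr0 ?card_ord //.
by move=> i j /(congr1 val)/enum_val_inj/cast_ord_inj.
Qed.

Lemma kappa_rel_vec t : (2%:R : F) != 0 -> kappa b (rel_vec F t) = 0.
Proof.
move=> char2; rewrite -(kappa_diag_rel t char2) /rel_vec linear_sum.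
by apply: eq_bigr => s _; rewrite linearZ /= kappa_vec.
Qed.

End Relations.

(** * Reduction of all diagrams to short ones modulo the relations *)

Section Straightening.
Variables m n : nat.
Implicit Types (D : brauer n) (S : {set 'I_n}) (t : rel_datum m n).

Lemma ptS_surj t x : x \in rel_S t -> exists i, x = val (ptS t i).
Proof.
move=> xS; exists (cast_ord (esym (card_rel_S t)) (enum_rank_in xS x)).
by rewrite /= cast_ordKV enum_rankK_in.
Qed.

Lemma ptS'_surj t x : x \in rel_S' t -> exists i, x = val (ptS' t i).
Proof.
move=> xS; exists (cast_ord (esym (card_rel_S' t)) (enum_rank_in xS x)).
by rewrite /= cast_ordKV enum_rankK_in.
Qed.

Section Datum.
Variable t : rel_datum m n.
Implicit Type s : {perm {x | x \in rel_S t}}.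

Lemma partner_relS s i :
  partner (rel_diagram s) (val (s (ptS t i))) = val (ptS' t i).
Proof.
have [_ _ dS _] := rel_datumP t.
apply: partner_eq; last by apply/setUP; right; apply: imset_f.
by apply: contraTneq (valP (ptS' t i)) => <-; rewrite (disjointFr dS) //; apply: valP.
Qed.

Lemma partner_relS' s i :
  partner (rel_diagram s) (val (ptS' t i)) = val (s (ptS t i)).
Proof. by rewrite -(partner_relS s) partnerK. Qed.

Lemma partner_rel_out s s' x : x \notin rel_S t -> x \notin rel_S' t ->
  partner (rel_diagram s) x = partner (rel_diagram s') x.
Proof.
move=> xS xS'; apply/esym/partner_eq; first by rewrite eq_sym partner_neq.
have /setUP[BP|/imsetP[i _ /setP/(_ x)]] := partner_block (rel_diagram s) x.
  by apply/setUP; left.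
rewrite set21 !inE => /esym/orP[]/eqP ex; [case/negP: xS|case/negP: xS'];
  rewrite ex; apply: valP.
Qed.

Lemma rel_diagram_inj : injective (@rel_diagram m n t).
Proof.
move=> s s' e; apply/permP => x; have [i /val_inj->] := ptS_surj (valP x).
apply/val_inj/(@partner_inj _ (rel_diagram s)).
by rewrite partner_relS e partner_relS.
Qed.

Local Notation perm1S := (1%g : {perm {x | x \in rel_S t}}).

Lemma partner_word_rel_lt s :
  s != perm1S -> (partner_word (rel_diagram perm1S) < partner_word (rel_diagram s))%O.
Proof.
move=> s1; rewrite ltNge; apply: contra s1; rewrite le_eqVlt.
case/orP=> [/eqP/partner_word_inj/rel_diagram_inj->//|].
case/partner_word_ltP => k eqk ltk; exfalso.
set w := partner (rel_diagram perm1S) in eqk ltk.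
set w' := partner (rel_diagram s) in eqk ltk.
have wS i : w (val (ptS t i)) = val (ptS' t i) by rewrite -(partner_relS perm1S) perm1.
have wS' i : w (val (ptS' t i)) = val (ptS t i) by rewrite /w partner_relS' perm1.
(* At the first point k where w and w' differ, w' k = w j for some j on the same
   side (S or S') as k; agreement below k forces k <= j, and w is increasing on
   each side. *)
have sub (j : 'I_n) : w' k = w j -> (k <= j)%N.
  move=> e; rewrite leqNgt; apply/negP => jk.
  have /partner_inj ekj : w' k = w' j by rewrite e eqk.
  by rewrite ekj ltnn in jk.
case kS: (k \in rel_S t).
  pose y : {x | x \in rel_S t} := exist _ k kS.
  have [i /val_inj ei] := ptS_surj (valP (s^-1%g y)).
  have ek : k = val (s (ptS t i)) by rewrite -ei permKV.
  have ew : w' k = val (ptS' t i) by rewrite ek; apply: partner_relS.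
  have [j ekj] := ptS_surj kS.
  have := sub (val (ptS t i)); rewrite wS => /(_ ew).
  move: ltk; rewrite ew [in w k]ekj wS {1}ekj.
  case: (ltngtP i j) => [ij|ij|/val_inj->]; rewrite ?ltnn //.
    by have [+ _] := pt_increasing t ij; rewrite ltnNge => /negP nle _ /nle.
  by have [_] := pt_increasing t ij; case: ltngtP.
case kS': (k \in rel_S' t).
  have [j ek] := ptS'_surj kS'.
  have [i /val_inj ei] := ptS_surj (valP (s (ptS t j))).
  have ew : w' k = val (ptS t i) by rewrite ek -ei; apply: partner_relS'.
  have := sub (val (ptS' t i)); rewrite wS' => /(_ ew).
  move: ltk; rewrite ew ek wS'.
  case: (ltngtP i j) => [ij|ij|/val_inj->]; rewrite ?ltnn //.
    by have [_ +] := pt_increasing t ij; rewrite ltnNge => /negP nle _ /nle.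
  by have [] := pt_increasing t ij; case: ltngtP.
by move: ltk; rewrite /w' (partner_rel_out s perm1S) ?kS ?kS' // ltnn.
Qed.

End Datum.

(** Both value lists are strictly sorted with the same members, and such a list is unique. *)
Lemma increasing_enum_uniq k (f g : 'I_k -> 'I_n) :
  {homo f : i j / (i < j)%N} -> {homo g : i j / (i < j)%N} ->
  f @: setT = g @: setT -> f =1 g.
Proof.
move=> hf hg fg.
pose r (q : nat) : rel 'I_q := fun x y => (x < y)%N.
have so : sorted (r k) (enum 'I_k).
  by have := iota_ltn_sorted 0 k; rewrite -val_enum_ord sorted_map.
have sf (h : 'I_k -> 'I_n) : {homo h : i j / (i < j)%N} -> sorted (r n) (map h (enum 'I_k)).
  by move=> hh; apply: homo_sorted so.
have e : map f (enum 'I_k) = map g (enum 'I_k).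
  apply: (@irr_sorted_eq _ (r n)); rewrite ?sf //.
  - by move=> x y z; apply: ltn_trans.
  - by move=> x; rewrite /r ltnn.
  move=> x; have := congr1 (fun A : {set 'I_n} => x \in A) fg.
  have E (h : 'I_k -> 'I_n) : (x \in h @: setT) = (x \in map h (enum 'I_k)).
    apply/imsetP/mapP => -[i _ ->]; exists i => //; exact: mem_enum.
  by rewrite !E.
by move=> i; have /eq_in_map/(_ i) := e; rewrite mem_enum; apply.
Qed.

Lemma chain_rel_diagram D S : chain D S -> #|S| = m.+1 ->
  exists t : rel_datum m n, rel_diagram (1%g : {perm {x | x \in rel_S t}}) = D.
Proof.
move=> cS cardS; set S' := partner D @: S.
(* Since [S :|: S'] is stable under the involution, each block lies inside it or misses it; the
   latter blocks form a pairing of the complement. *)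
pose P := [set B in val D | [disjoint B & S :|: S']].
have mS' x : (x \in S') = (partner D x \in S).
  by rewrite -{1}(partnerK D x) mem_imset //; apply: partner_inj.
have mU x : (partner D x \in S :|: S') = (x \in S :|: S').
  by rewrite !inE !mS' partnerK orbC.
have pt : is_rel_datum m (S, S', P).
  apply/and4P; split; first exact/eqP.
  - by rewrite card_imset ?cardS //; apply: partner_inj.
  - exact: chain_partner_disjoint.
  case: (andP (valP D)) => /and3P[_ tD nD] /forall_inP card2.
  apply/andP; split; last by apply/forall_inP => B; rewrite inE => /andP[/card2].
  apply/and3P; split.
  - apply/eqP/setP => x; rewrite in_setC; apply/bigcupP/idP => [[B]|xU].
      by rewrite inE => /andP[_ dB] xB; rewrite (disjointFr dB).
    exists [set x; partner D x]; last exact: set21.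
    rewrite inE partner_block -setI_eq0; apply/eqP/setP => y; rewrite in_setI in_set0.
    apply/negP => /andP[/set2P[]->]; first exact/negP.
    by rewrite mU; apply/negP.
  - by apply: trivIsetS tD; apply/subsetP => B; rewrite inE => /andP[].
  - by rewrite inE negb_and nD.
pose t : rel_datum m n := exist (fun u => is_rel_datum m u) _ pt; exists t.
(* The involution is increasing on [S], so it matches the increasing enumerations of [S] and [S']
   index by index; this is why the identity permutation yields [D]. *)
have wpt i : partner D (val (ptS t i)) = val (ptS' t i).
  apply: (@increasing_enum_uniq _ (fun i => partner D (val (ptS t i))) (fun i => val (ptS' t i))).
  - move=> j k /(pt_increasing t)[jk _]; rewrite (chain_lt cS) //; exact: valP.
  - by move=> j k /(pt_increasing t)[].
  - apply/setP => x; apply/imsetP/imsetP => -[j _ ex].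
      have xS' : x \in rel_S' t by rewrite ex; apply: imset_f; apply: valP.
      have [k ek] := ptS'_surj xS'; exists k => //.
    have : partner D x \in rel_S t by rewrite -mS' ex; apply: valP.
    move=> xS; have [k ek] := ptS_surj xS; exists k => //.
    by rewrite -ek partnerK.
apply: brauer_ext => x; apply/esym/partner_eq; first by rewrite eq_sym partner_neq.
have /setUP[|/imsetP[i _ ->]] := partner_block (rel_diagram (1%g : {perm {x | x \in rel_S t}})) x.
  by rewrite inE => /andP[].
by rewrite perm1 -wpt partner_block.
Qed.

Lemma not_short D : ~~ short m D -> exists2 S, chain D S & #|S| = m.+1.
Proof.
case/forallPn => S; rewrite negb_imply -ltnNge => /andP[cS ltm].
(* A chain that is too long is cut down to exactly [m.+1] points. *)
exists [set x in take m.+1 (enum S)].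
  apply: chain_sub cS; apply/subsetP => x; rewrite inE => /mem_take.
  by rewrite mem_enum.
rewrite cardsE; have /card_uniqP-> := take_uniq m.+1 (enum_uniq (mem S)).
by rewrite size_takel // -cardE.
Qed.

(** A chain of size [m.+1] and its disjoint image together occupy [2 * m.+1] points. *)
Lemma short_small D : (n < 2 * m.+1)%N -> short m D.
Proof.
apply: contraTT => /not_short[S cS cardS]; rewrite -leqNgt.
have : (#|S :|: partner D @: S| <= n)%N by rewrite -[X in (_ <= X)%N]card_ord max_card.
rewrite cardsU (disjoint_setI0 (chain_partner_disjoint cS)) cards0 subn0.
by rewrite card_imset ?cardS ?mul2n ?addnn //; apply: partner_inj.
Qed.

Variable F : fieldType.

Definition rel_span : {vspace brauer_space F n} :=
  <<codom (fun t : rel_datum m n => rel_vec F t)>>.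
Definition short_span : {vspace brauer_space F n} :=
  <<[seq diagram_vec F D | D <- enum {: brauer n} & short m D]>>.

Lemma straightening D : diagram_vec F D \in (rel_span + short_span)%VS.
Proof.
(* Induction on the number of diagrams with a larger word, which drops for every non-identity term
   of the relation. *)
have [N] := ubnP #|[set E : brauer n | (partner_word D < partner_word E)%O]|.
elim: N D => // N IH D; rewrite ltnS => leN.
have [sD|/not_short[S cS cardS]] := boolP (short m D).
  apply: (subvP (addvSr _ _)); apply: memv_span; apply: map_f.
  by rewrite mem_filter sD mem_enum.
have [t tD] := chain_rel_diagram cS cardS.
have -> : diagram_vec F D = rel_vec F t -
    \sum_(s : {perm {x | x \in rel_S t}} | s != 1%g)
      (-1) ^+ odd_perm s *: diagram_vec F (rel_diagram s).
  by rewrite /rel_vec (bigD1 (1%g : {perm {x | x \in rel_S t}})) //= odd_perm1 scale1r tD addrK.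
apply: rpredB.
  by apply: (subvP (addvSl _ _)); apply: memv_span; apply: codom_f.
apply: rpred_sum => s /partner_word_rel_lt; rewrite tD => lts; apply: rpredZ; apply: IH.
apply: leq_trans leN; apply: proper_card; apply/properP; split.
  by apply/subsetP => E; rewrite !inE; apply: lt_trans.
by exists (rel_diagram s); rewrite !inE ?lts ?ltxx.
Qed.

Lemma brauer_spanned (x : brauer_space F n) : x \in (rel_span + short_span)%VS.
Proof.
have -> : x = \sum_D (x D : F) *: diagram_vec F D.
  apply/ffunP => D; rewrite sum_ffunE (bigD1 D) //= big1 => [|E nE].
    by rewrite !ffunE eqxx addr0 [_ *: _]mulr1.
  by rewrite !ffunE eq_sym (negbTE nE) [_ *: _]mulr0.
by apply: rpred_sum => D _; apply/rpredZ/straightening.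
Qed.

End Straightening.

Lemma span_ind (F : fieldType) (vT : vectType F) (X : seq vT) (P : vT -> Prop) :
  P 0 -> (forall a u v, P u -> P v -> P (a *: u + v)) ->
  (forall x, x \in X -> P x) -> forall v, v \in <<X>>%VS -> P v.
Proof.
move=> P0 Plin PX v; rewrite -[X]/(tval (in_tuple X)) => /coord_span->.
elim/big_rec: _ => // i u _ Pu; apply: Plin => //; apply: PX.
exact: mem_nth.
Qed.

(** * Determination of the kernel *)

Section Kernel.
Variables (F : fieldType) (m n : nat) (b : {symmetric 'rV[F]_m}).
Hypothesis char2 : (2%:R : F) != 0.

Lemma kappa_rel_span u : u \in rel_span m n F -> kappa b u = 0.
Proof.
move: u; apply: (@span_ind _ _ _ (fun u => kappa b u = 0)) => [|a u v ku kv|_ /codomP[t ->]].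
- exact: linear0.
- by rewrite kappa_linear ku kv scaler0 addr0.
- exact: kappa_rel_vec.
Qed.

Lemma short_span_support D u : ~~ short m D -> u \in short_span m n F -> u D = 0.
Proof.
move=> nD; rewrite /short_span.
apply: (@span_ind _ _ _ (fun u : brauer_space F n => u D = 0)) =>
  [|a {}u v uD vD|_ /mapP[E + ->]].
- by rewrite ffunE.
- by rewrite !ffunE uD vD [_ *: _]mulr0 addr0.
- rewrite mem_filter ffunE => /andP[sE _].
  by case: eqP => // e; rewrite e sE in nD.
Qed.

(** In a decomposition of [x] into relations and short diagrams, [kappa] kills the first summand, so
    the short summand lies in the kernel and vanishes by independence. *)
Lemma kappa_ker (x : brauer_space F n) : nondegenerate b ->
  kappa b x = 0 -> x \in rel_span m n F.
Proof.
move=> ndb kx; have /memv_addP[u uR [w wS e]] := brauer_spanned m x.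
suff w0 : w = 0 by rewrite e w0 addr0.
apply: (kappa_short_inj char2 ndb) => [D|].
  by apply: contraNT => nD; rewrite (short_span_support nD wS).
by move: kx; rewrite e linearD /= (kappa_rel_span uR) add0r.
Qed.

End Kernel.

Theorem theorem6p3 (R : realType) (m d : nat) (b : {symmetric 'rV[R[i]]_m}) :
  nondegenerate b -> (1 <= d)%N ->
  ((d <= m)%N ->
     forall x : brauer_space R[i] (2 * d), kappa b x = 0 -> x = 0)
  /\
  ((m.+1 <= d)%N ->
     (forall t : rel_datum m (2 * d),
        \sum_(s : {perm {x | x \in rel_S t}})
          (-1) ^+ odd_perm s *: kappa_diag b (rel_diagram s) = 0)
     /\
     (forall x : brauer_space R[i] (2 * d), kappa b x = 0 ->
        x \in <<codom (fun t : rel_datum m (2 * d) => rel_vec R[i] t)>>%VS)).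
Proof.
move=> ndb _; have char2 : (2%:R : R[i]) != 0 by rewrite pnatr_eq0.
split=> [ledm x kx|_].
  apply: (kappa_short_inj char2 ndb) kx => D _.
  by apply: short_small; rewrite ltn_pmul2l.
split=> [t|x kx]; first exact: kappa_diag_rel.
have := kappa_ker char2 ndb kx; exact.
Qed.
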